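(* (Cuntz-Krieger uniqueness theorem.) Let $\Lambda$ be an aperiodic row-finite $k$-graph without sources, let $R$ be a commutative ring with $1$, and let $A$ be a ring. If $\pi:\mathrm{KP}_R(\Lambda)\to A$ is a ring homomorphism such that $\pi(rp_v)\neq0$ for all $r\in R\setminus\{0\}$ and $v\in\Lambda^0$, then $\pi$ is injective.
   Context: Conventions: $\mathbb{N}$ includes $0$, and $k$ is a positive integer. For $m,n\in\mathbb{N}^k$, $m\le n$ is coordinatewise and $m\vee n$ is the coordinatewise maximum. Rings and $R$-algebras are associative but not assumed to have an identity, and homomorphisms are not assumed unit-preserving. A $k$-graph is a countable category $\Lambda$ (with object set $\Lambda^0$, set of morphisms also written $\Lambda$, domain map $s$, codomain map $r$; $\lambda\mu$ is defined when $s(\lambda)=r(\mu)$) together with a functor $d:\Lambda\to\mathbb{N}^k$ (where $\mathbb{N}^k$ is viewed as a category with one object) with the factorization property: if $d(\lambda)=m+n$ there are unique $\mu,\nu\in\Lambda$ with $d(\mu)=m$, $d(\nu)=n$, $\lambda=\mu\nu$. Objects are identified with identity morphisms, so $\Lambda^0=d^{-1}(0)$. Write $\Lambda^n=d^{-1}(n)$, $v\Lambda=\{\lambda\in\Lambda:r(\lambda)=v\}$ and $v\Lambda^n=v\Lambda\cap\Lambda^n$. $\Lambda$ is row-finite if every $v\Lambda^n$ ($v\in\Lambda^0$, $n\in\mathbb{N}^k$) is finite, and has no sources if every $v\Lambda^n$ is nonempty. For $\lambda\in\Lambda$ and $0\le m\le n\le d(\lambda)$, write $\lambda=\lambda'\lambda''\lambda'''$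 uniquely with $d(\lambda')=m$, $d(\lambda'')=n-m$, $d(\lambda''')=d(\lambda)-n$, and put $\lambda(m,n):=\lambda''$. $\Lambda$ is aperiodic if for every $v\in\Lambda^0$ and all $m\neq n$ in $\mathbb{N}^k$ there is $\lambda\in v\Lambda$ with $d(\lambda)\ge m\vee n$ and $\lambda(m,m+d(\lambda)-(m\vee n))\neq\lambda(n,n+d(\lambda)-(m\vee n))$. Let $\Lambda^{\neq0}=\{\lambda\in\Lambda:d(\lambda)\neq0\}$. For each $\lambda\in\Lambda^{\neq0}$ introduce a formal symbol $\lambda^*$ (ghost path), and let $G(\Lambda^{\neq0})=\{\lambda^*:\lambda\in\Lambda^{\neq0}\}$. A Kumjian-Pask $\Lambda$-family $(P,S)$ in an $R$-algebra $A$ consists of functions $P:\Lambda^0\to A$ and $S:\Lambda^{\neq0}\cup G(\Lambda^{\neq0})\to A$ such that: (KP1) $\{P_v:v\in\Lambda^0\}$ is a family of mutually orthogonal idempotents; (KP2) for all $\lambda,\mu\in\Lambda^{\neq0}$ with $r(\mu)=s(\lambda)$: $S_\lambda S_\mu=S_{\lambda\mu}$, $S_{\mu^*}S_{\lambda^*}=S_{(\lambda\mu)^*}$, $P_{r(\lambda)}S_\lambda=S_\lambda=S_\lambda P_{s(\lambda)}$, $P_{s(\lambda)}S_{\lambda^*}=S_{\lambda^*}=S_{\lambda^*}P_{r(\lambda)}$; (KP3) for all $\lambda,\mu\in\Lambda^{\neq0}$ with $d(\lambda)=d(\mu)$: $S_{\lambda^*}S_\mu=\delta_{\lambda,\mu}P_{s(\lambda)}$;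 (KP4) for all $v\in\Lambda^0$ and $n\in\mathbb{N}^k\setminus\{0\}$: $P_v=\sum_{\lambda\in v\Lambda^n}S_\lambda S_{\lambda^*}$. The Kumjian-Pask algebra $\mathrm{KP}_R(\Lambda)$ is the $R$-algebra generated by a universal Kumjian-Pask $\Lambda$-family $(p,s)$ (the free $R$-algebra on $\Lambda^0\cup\Lambda^{\neq0}\cup G(\Lambda^{\neq0})$ modulo the relations (KP1)-(KP4)). *)

(* Defs.v *)
From HB Require Import structures.
From mathcomp Require Import all_boot all_order all_algebra.
From mathcomp Require Import boolp classical_sets cardinality.

Set Implicit Arguments.
Unset Strict Implicit.
Unset Printing Implicit Defensive.

Import GRing.Theory.
Local Open Scope ring_scope.
Local Open Scope classical_set_scope.
Local Open Scope quotient_scope.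

HB.mixin Record Zmodule_isNuRing A of GRing.Zmodule A := {
  numul : A -> A -> A;
  numulA : associative numul;
  numulDl : left_distributive numul +%R;
  numulDr : right_distributive numul +%R;
}.

#[short(type="nuRingType")]
HB.structure Definition NuRing := {A of Zmodule_isNuRing A & GRing.Zmodule A}.

Declare Scope nuring_scope.
Delimit Scope nuring_scope with nu.
Notation "x ** y" := (numul x y)
  (at level 40, left associativity) : nuring_scope.
Local Open Scope nuring_scope.

HB.mixin Record NuRing_isNuAlgebra (R : comPzRingType) A
    of NuRing A & GRing.Lmodule R A := {
  nuscaleAl : forall (a : R) (x y : A), a *: (x ** y) = (a *: x) ** y;
  nuscaleAr : forall (a : R) (x y : A), a *: (x ** y) = x ** (a *: y);
}.

#[short(type="nuAlgType")]
HB.structure Definition NuAlgebra (R : comPzRingType) :=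
  {A of NuRing_isNuAlgebra R A & NuRing A & GRing.Lmodule R A}.

Notation degree k := {ffun 'I_k -> nat}.

Section Degree.
Variable k : nat.
Implicit Types m n : degree k.

Definition degle m n : Prop := forall i, (m i <= n i)%N.
Definition degmax m n : degree k := [ffun i => maxn (m i) (n i)].
(* Truncated subtraction, only used when the second argument is smaller. *)
Definition degsub m n : degree k := [ffun i => (m i - n i)%N].

Lemma degsubK m n : degle m n -> m + degsub n m = n.
Proof. by move=> le_mn; apply/ffunP => i; rewrite !ffunE; apply: subnKC. Qed.
End Degree.

(* The composite [cmp l m] is total, but it is meaningful only when
   [src l = rng m]: its other values are arbitrary and never used. *)
Record kgraph (k : nat) := KGraph {
  obj : countType;
  mor : countType;
  src : mor -> obj;
  rng : mor -> obj;
  idm : obj -> mor;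
  cmp : mor -> mor -> mor;
  deg : mor -> degree k;
  src_id : forall v, src (idm v) = v;
  rng_id : forall v, rng (idm v) = v;
  src_cmp : forall l m, src l = rng m -> src (cmp l m) = src m;
  rng_cmp : forall l m, src l = rng m -> rng (cmp l m) = rng l;
  cmpA : forall l m n, src l = rng m -> src m = rng n ->
    cmp l (cmp m n) = cmp (cmp l m) n;
  cmp_idl : forall l, cmp (idm (rng l)) l = l;
  cmp_idr : forall l, cmp l (idm (src l)) = l;
  deg_id : forall v, deg (idm v) = 0;
  deg_cmp : forall l m, src l = rng m -> deg (cmp l m) = deg l + deg m;
  deg_fact : forall l (m n : degree k), deg l = m + n ->
    exists! p : mor * mor, [/\ deg p.1 = m, deg p.2 = n,
      src p.1 = rng p.2 & l = cmp p.1 p.2];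
}.

Section KGraphTheory.
Variables (k : nat) (L : kgraph k).
Implicit Types (v : obj L) (l : mor L) (m n : degree k).

Definition paths_from v n : set (mor L) := [set l | rng l = v /\ deg l = n].

Definition row_finite : Prop := forall v n, finite_set (paths_from v n).

Definition no_sources : Prop := forall v n, paths_from v n !=set0.

Definition is_segment l m n (x : mor L) : Prop := exists a b : mor L,
  [/\ deg a = m, deg x = degsub n m & deg b = degsub (deg l) n] /\
  [/\ src a = rng x, src x = rng b & l = cmp a (cmp x b)].

(* The path l(m, n); see [segmentP] and [is_segment_uniq]. *)
Definition segment l m n : mor L := xget l [set x | is_segment l m n x].

Lemma deg_fact_uniq (a b a' b' : mor L) :
  src a = rng b -> src a' = rng b' -> deg a = deg a' -> deg b = deg b' ->
  cmp a b = cmp a' b' -> a = a' /\ b = b'.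
Proof.
move=> ab ab' da db e.
have [p [_ U]] := deg_fact (deg_cmp ab).
have e1 : p = (a, b) by apply: U.
have e2 : p = (a', b') by apply: U; split.
by move: e2; rewrite e1 => -[-> ->].
Qed.

Lemma is_segment_uniq l m n x y :
  is_segment l m n x -> is_segment l m n y -> x = y.
Proof.
move=> [a [b [[da dx db] [ax xb e]]]] [a' [b' [[da' dy db'] [ay yb' e']]]].
have dxb : deg (cmp x b) = deg (cmp y b') by rewrite !deg_cmp// dx dy db db'.
have axb : src a = rng (cmp x b) by rewrite rng_cmp.
have ayb' : src a' = rng (cmp y b') by rewrite rng_cmp.
have [_ e2] := deg_fact_uniq axb ayb' (etrans da (esym da')) dxb
  (etrans (esym e) e').
by have [] := @deg_fact_uniq x b y b' xb yb' (etrans dx (esym dy))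
  (etrans db (esym db')) e2.
Qed.

Lemma segmentP l m n :
  degle m n -> degle n (deg l) -> is_segment l m n (segment l m n).
Proof.
move=> le_mn le_nl.
have [p1 [[dp1 dp2 sp lE] _]] : exists! p : mor L * mor L,
    [/\ deg p.1 = m, deg p.2 = degsub n m + degsub (deg l) n,
        src p.1 = rng p.2 & l = cmp p.1 p.2].
  by apply: deg_fact; rewrite addrA !degsubK.
have [p2 [[dq1 dq2 sq qE] _]] := deg_fact dp2.
apply: (@xgetPex _ l [set x | is_segment l m n x]).
exists p2.1, p1.1, p2.2; split; split=> //.
  by rewrite sp qE rng_cmp.
by rewrite -qE.
Qed.

Definition aperiodic : Prop := forall v m n, m != n ->
  exists l, [/\ rng l = v, degle (degmax m n) (deg l) &
    segment l m (degsub (m + deg l) (degmax m n)) !=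
    segment l n (degsub (n + deg l) (degmax m n))].

Definition nzmor := {l : mor L | deg l != 0}.

(* [ls] lists without repetition the set v L^n. When n != 0 every element of
   v L^n is in [nzmor], and such a list exists iff v L^n is finite. *)
Definition enumerates v n (ls : seq nzmor) : Prop :=
  uniq ls /\ forall l : nzmor, l \in ls <-> paths_from v n (val l).

Lemma row_finite_enum v n : row_finite -> n != 0 ->
  exists ls, enumerates v n ls.
Proof.
move=> rfL n0; have /finite_seqP[s sE] := rfL v n.
exists (undup (pmap insub s)); split; first exact: undup_uniq.
move=> l; rewrite mem_undup mem_pmap_sub.
by have -> : paths_from v n (val l) = (val l \in s) by rewrite sE.
Qed.

End KGraphTheory.

(* [S] is the family on paths and [Sg] the family on ghost paths.  In the two
   composition axioms [lm] always exists, since d(l) + d(m) is not 0. *)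
Record kp_family k (L : kgraph k) (A : nuRingType)
    (P : obj L -> A) (S Sg : nzmor L -> A) : Prop := KPFamily {
  kp1_idem : forall v, P v ** P v = P v;
  kp1_orth : forall v w, v != w -> P v ** P w = 0;
  kp2_mul : forall l m lm : nzmor L, rng (val m) = src (val l) ->
    val lm = cmp (val l) (val m) -> S l ** S m = S lm;
  kp2_gmul : forall l m lm : nzmor L, rng (val m) = src (val l) ->
    val lm = cmp (val l) (val m) -> Sg m ** Sg l = Sg lm;
  kp2_rng : forall l, P (rng (val l)) ** S l = S l;
  kp2_src : forall l, S l ** P (src (val l)) = S l;
  kp2_gsrc : forall l, P (src (val l)) ** Sg l = Sg l;
  kp2_grng : forall l, Sg l ** P (rng (val l)) = Sg l;
  kp3_eq : forall l, Sg l ** S l = P (src (val l));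
  kp3_neq : forall l m, deg (val l) = deg (val m) -> l != m ->
    Sg l ** S m = 0;
  kp4 : forall v n ls, n != 0 -> enumerates v n ls ->
    P v = \sum_(l <- ls) S l ** Sg l;
}.

(* KP_R(L) is the quotient of the formal expressions in the generators by the
   least congruence which contains both the axioms of R-algebras without
   identity and the Kumjian-Pask relations; see [kp_universal]. *)
Section KumjianPask.
Variables (k : nat) (L : kgraph k) (R : comPzRingType).

Inductive kp_term : Type :=
  | TP of obj L
  | TS of nzmor L
  | TSg of nzmor L
  | T0
  | TAdd of kp_term & kp_term
  | TOpp of kp_term
  | TScale of R & kp_term
  | TMul of kp_term & kp_term.

Inductive kp_rel : kp_term -> kp_term -> Prop :=
  | Rel1_idem v : kp_rel (TMul (TP v) (TP v)) (TP v)
  | Rel1_orth v w : v != w -> kp_rel (TMul (TP v) (TP w)) T0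
  | Rel2_mul (l m lm : nzmor L) : rng (val m) = src (val l) ->
      val lm = cmp (val l) (val m) -> kp_rel (TMul (TS l) (TS m)) (TS lm)
  | Rel2_gmul (l m lm : nzmor L) : rng (val m) = src (val l) ->
      val lm = cmp (val l) (val m) -> kp_rel (TMul (TSg m) (TSg l)) (TSg lm)
  | Rel2_rng l : kp_rel (TMul (TP (rng (val l))) (TS l)) (TS l)
  | Rel2_src l : kp_rel (TMul (TS l) (TP (src (val l)))) (TS l)
  | Rel2_gsrc l : kp_rel (TMul (TP (src (val l))) (TSg l)) (TSg l)
  | Rel2_grng l : kp_rel (TMul (TSg l) (TP (rng (val l)))) (TSg l)
  | Rel3_eq l : kp_rel (TMul (TSg l) (TS l)) (TP (src (val l)))
  | Rel3_neq l m : deg (val l) = deg (val m) -> l != m ->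
      kp_rel (TMul (TSg l) (TS m)) T0
  | Rel4 v n ls : n != 0 -> enumerates v n ls ->
      kp_rel (TP v) (\big[TAdd/T0]_(l <- ls) TMul (TS l) (TSg l)).

Inductive kp_congr : kp_term -> kp_term -> Prop :=
  | Crel x y : kp_rel x y -> kp_congr x y
  | Crefl x : kp_congr x x
  | Csym x y : kp_congr x y -> kp_congr y x
  | Ctrans x y z : kp_congr x y -> kp_congr y z -> kp_congr x z
  | Cadd x x' y y' : kp_congr x x' -> kp_congr y y' ->
      kp_congr (TAdd x y) (TAdd x' y')
  | Copp x x' : kp_congr x x' -> kp_congr (TOpp x) (TOpp x')
  | Cscale a x x' : kp_congr x x' -> kp_congr (TScale a x) (TScale a x')
  | Cmul x x' y y' : kp_congr x x' -> kp_congr y y' ->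
      kp_congr (TMul x y) (TMul x' y')
  | CaddA x y z : kp_congr (TAdd x (TAdd y z)) (TAdd (TAdd x y) z)
  | CaddC x y : kp_congr (TAdd x y) (TAdd y x)
  | Cadd0 x : kp_congr (TAdd T0 x) x
  | CaddN x : kp_congr (TAdd (TOpp x) x) T0
  | CscaleA a b x : kp_congr (TScale a (TScale b x)) (TScale (a * b) x)
  | Cscale1 x : kp_congr (TScale 1 x) x
  | CscaleDr a x y :
      kp_congr (TScale a (TAdd x y)) (TAdd (TScale a x) (TScale a y))
  | CscaleDl a b x :
      kp_congr (TScale (a + b) x) (TAdd (TScale a x) (TScale b x))
  | CmulA x y z : kp_congr (TMul x (TMul y z)) (TMul (TMul x y) z)
  | CmulDl x y z : kp_congr (TMul (TAdd x y) z) (TAdd (TMul x z) (TMul y z))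
  | CmulDr x y z : kp_congr (TMul x (TAdd y z)) (TAdd (TMul x y) (TMul x z))
  | CscaleAl a x y : kp_congr (TScale a (TMul x y)) (TMul (TScale a x) y)
  | CscaleAr a x y : kp_congr (TScale a (TMul x y)) (TMul x (TScale a y)).

HB.instance Definition _ := gen_eqMixin kp_term.
HB.instance Definition _ := gen_choiceMixin kp_term.

Definition kp_congrb : rel kp_term := fun x y => `[< kp_congr x y >].

Lemma kp_congrb_refl : reflexive kp_congrb.
Proof. by move=> x; apply/asboolP/Crefl. Qed.

Lemma kp_congrb_sym : symmetric kp_congrb.
Proof. by move=> x y; apply/asboolP/asboolP; apply: Csym. Qed.

Lemma kp_congrb_trans : transitive kp_congrb.
Proof. by move=> y x z /asboolP xy /asboolP yz; apply/asboolP/(Ctrans xy). Qed.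

Canonical kp_congr_equiv :=
  EquivRel kp_congrb kp_congrb_refl kp_congrb_sym kp_congrb_trans.

Definition KP : Type := {eq_quot kp_congr_equiv}.

HB.instance Definition _ := Choice.on KP.
HB.instance Definition _ := Quotient.on KP.

Lemma kp_pi_eq (x y : kp_term) :
  \pi_KP x = \pi_KP y <-> kp_congr x y.
Proof.
split=> [/eqquotP/asboolP//|xy].
by apply/eqquotP/asboolP.
Qed.

Lemma kp_reprP (x : kp_term) : kp_congr (repr (\pi_KP x)) x.
Proof. by apply/kp_pi_eq; rewrite reprK. Qed.

Definition kp_zero : KP := \pi_KP T0.
Definition kp_add (x y : KP) : KP := \pi_KP (TAdd (repr x) (repr y)).
Definition kp_opp (x : KP) : KP := \pi_KP (TOpp (repr x)).
Definition kp_scale (a : R) (x : KP) : KP := \pi_KP (TScale a (repr x)).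
Definition kp_mul (x y : KP) : KP := \pi_KP (TMul (repr x) (repr y)).

Let piD x y : kp_add (\pi_KP x) (\pi_KP y) = \pi_KP (TAdd x y).
Proof. by apply/kp_pi_eq/Cadd; apply: kp_reprP. Qed.
Let piN x : kp_opp (\pi_KP x) = \pi_KP (TOpp x).
Proof. by apply/kp_pi_eq/Copp; apply: kp_reprP. Qed.
Let piZ a x : kp_scale a (\pi_KP x) = \pi_KP (TScale a x).
Proof. by apply/kp_pi_eq/Cscale; apply: kp_reprP. Qed.
Let piM x y : kp_mul (\pi_KP x) (\pi_KP y) = \pi_KP (TMul x y).
Proof. by apply/kp_pi_eq/Cmul; apply: kp_reprP. Qed.

Let kp_addA : associative kp_add.
Proof.
elim/quotW=> x; elim/quotW=> y; elim/quotW=> z.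
by rewrite (piD y z) (piD x y) !piD; apply/kp_pi_eq; apply: CaddA.
Qed.
Let kp_addC : commutative kp_add.
Proof.
elim/quotW=> x; elim/quotW=> y.
by rewrite !piD; apply/kp_pi_eq; apply: CaddC.
Qed.
Let kp_add0 : left_id kp_zero kp_add.
Proof. by elim/quotW=> x; rewrite piD; apply/kp_pi_eq; apply: Cadd0. Qed.
Let kp_addN : left_inverse kp_zero kp_opp kp_add.
Proof.
by elim/quotW=> x; rewrite (piN x) piD; apply/kp_pi_eq; apply: CaddN.
Qed.

HB.instance Definition _ :=
  GRing.isZmodule.Build KP kp_addA kp_addC kp_add0 kp_addN.

Let kp_scaleA a b x : kp_scale a (kp_scale b x) = kp_scale (a * b) x.
Proof.
by elim/quotW: x => x; rewrite (piZ b) !piZ; apply/kp_pi_eq; apply: CscaleA.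
Qed.
Let kp_scale1 : left_id 1 kp_scale.
Proof. by elim/quotW=> x; rewrite piZ; apply/kp_pi_eq; apply: Cscale1. Qed.
Let kp_scaleDr : right_distributive kp_scale +%R.
Proof.
move=> a; elim/quotW=> x; elim/quotW=> y; rewrite -![_ + _]/(kp_add _ _).
by rewrite (piD x) !(piZ a) piD; apply/kp_pi_eq; apply: CscaleDr.
Qed.
Let kp_scaleDl x : {morph kp_scale^~ x : a b / a + b}.
Proof.
move=> a b; elim/quotW: x => x; rewrite -[RHS]/(kp_add _ _).
by rewrite !(piZ _ x) piD; apply/kp_pi_eq; apply: CscaleDl.
Qed.

HB.instance Definition _ := GRing.Zmodule_isLmodule.Build R KP
  kp_scaleA kp_scale1 kp_scaleDr kp_scaleDl.

Let kp_mulA : associative kp_mul.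
Proof.
elim/quotW=> x; elim/quotW=> y; elim/quotW=> z.
by rewrite (piM y z) (piM x y) !piM; apply/kp_pi_eq; apply: CmulA.
Qed.
Let kp_mulDl : left_distributive kp_mul +%R.
Proof.
elim/quotW=> x; elim/quotW=> y; elim/quotW=> z; rewrite -![_ + _]/(kp_add _ _).
by rewrite (piD x) !(piM _ z) piD; apply/kp_pi_eq; apply: CmulDl.
Qed.
Let kp_mulDr : right_distributive kp_mul +%R.
Proof.
elim/quotW=> x; elim/quotW=> y; elim/quotW=> z; rewrite -![_ + _]/(kp_add _ _).
by rewrite (piD y) !(piM x) piD; apply/kp_pi_eq; apply: CmulDr.
Qed.

HB.instance Definition _ :=
  Zmodule_isNuRing.Build KP kp_mulA kp_mulDl kp_mulDr.

Let kp_scaleAl (a : R) (x y : KP) : a *: (x ** y) = (a *: x) ** y.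
Proof.
elim/quotW: x => x; elim/quotW: y => y.
rewrite -![_ ** _]/(kp_mul _ _) -![_ *: _]/(kp_scale _ _).
by rewrite (piM x) (piZ a x) piM piZ; apply/kp_pi_eq; apply: CscaleAl.
Qed.
Let kp_scaleAr (a : R) (x y : KP) : a *: (x ** y) = x ** (a *: y).
Proof.
elim/quotW: x => x; elim/quotW: y => y.
rewrite -![_ ** _]/(kp_mul _ _) -![_ *: _]/(kp_scale _ _).
by rewrite (piM x y) (piZ a y) piM piZ; apply/kp_pi_eq; apply: CscaleAr.
Qed.

HB.instance Definition _ :=
  NuRing_isNuAlgebra.Build R KP kp_scaleAl kp_scaleAr.

Definition kp_p (v : obj L) : KP := \pi_KP (TP v).
Definition kp_s (l : nzmor L) : KP := \pi_KP (TS l).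
Definition kp_sg (l : nzmor L) : KP := \pi_KP (TSg l).

Lemma kp_piD x y : \pi_KP (TAdd x y) = \pi_KP x + \pi_KP y.
Proof. by rewrite -piD. Qed.
Lemma kp_pi0 : \pi_KP T0 = 0. Proof. by []. Qed.
Lemma kp_piN x : \pi_KP (TOpp x) = - \pi_KP x.
Proof. by rewrite -piN. Qed.
Lemma kp_piZ a x : \pi_KP (TScale a x) = a *: \pi_KP x.
Proof. by rewrite -piZ. Qed.
Lemma kp_piM x y : \pi_KP (TMul x y) = \pi_KP x ** \pi_KP y.
Proof. by rewrite -piM. Qed.

Lemma kp_pi_sum (I : Type) (s : seq I) (F : I -> kp_term) :
  \pi_KP (\big[TAdd/T0]_(i <- s) F i) = \sum_(i <- s) \pi_KP (F i).
Proof. by apply: (big_morph (fun x => \pi_KP x) kp_piD). Qed.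

Lemma kp_familyP : kp_family kp_p kp_s kp_sg.
Proof.
have rel x y : kp_rel x y -> \pi_KP x = \pi_KP y.
  by move=> xy; apply/kp_pi_eq; apply: Crel.
split; rewrite /kp_p /kp_s /kp_sg.
- by move=> v; rewrite -kp_piM; apply: rel; constructor.
- by move=> v w vw; rewrite -kp_piM; apply: rel; constructor.
- by move=> l m lm ml e; rewrite -kp_piM; apply: rel; apply: Rel2_mul.
- by move=> l m lm ml e; rewrite -kp_piM; apply: rel; apply: Rel2_gmul.
- by move=> l; rewrite -kp_piM; apply: rel; constructor.
- by move=> l; rewrite -kp_piM; apply: rel; constructor.
- by move=> l; rewrite -kp_piM; apply: rel; constructor.
- by move=> l; rewrite -kp_piM; apply: rel; constructor.
- by move=> l; rewrite -kp_piM; apply: rel; constructor.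
- by move=> l m dlm lm; rewrite -kp_piM; apply: rel; constructor.
- move=> v n ls n0 lsE; under eq_bigr do rewrite -kp_piM.
  by rewrite -kp_pi_sum; apply: rel; apply: Rel4 n0 lsE.
Qed.

Definition nualg_morphism (A B : nuAlgType R) (f : A -> B) : Prop :=
  [/\ {morph f : x y / x + y}, forall a, {morph f : x / a *: x} &
      {morph f : x y / x ** y}].

Lemma kp_universal (A : nuAlgType R) (P : obj L -> A) (S Sg : nzmor L -> A) :
  kp_family P S Sg ->
  exists! f : KP -> A, nualg_morphism f /\
    [/\ f \o kp_p = P, f \o kp_s = S & f \o kp_sg = Sg].
Proof.
move=> fam.
pose fix ev (t : kp_term) : A := match t with
  | TP v => P v | TS l => S l | TSg l => Sg l | T0 => 0
  | TAdd x y => ev x + ev y | TOpp x => - ev x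
  | TScale a x => a *: ev x | TMul x y => ev x ** ev y end.
have ev_rel x y : kp_rel x y -> ev x = ev y.
  case=> /=; try by case: fam.
  move=> v n ls n0 lsE; rewrite (kp4 fam n0 lsE).
  by rewrite (big_morph ev (id1 := 0) (op1 := +%R)).
have ev_congr x y : kp_congr x y -> ev x = ev y.
  elim=> //= {x y}; try by move=> *; congruence.
  - by move=> *; apply: addrA.
  - by move=> *; apply: addrC.
  - by move=> *; apply: add0r.
  - by move=> *; apply: addNr.
  - by move=> *; apply: scalerA.
  - by move=> *; apply: scale1r.
  - by move=> *; apply: scalerDr.
  - by move=> a b x; apply: scalerDl.
  - by move=> *; apply: numulA.
  - by move=> *; apply: numulDl.
  - by move=> *; apply: numulDr.
  - by move=> *; apply: nuscaleAl.
  - by move=> *; apply: nuscaleAr.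
have evE x : ev (repr (\pi_KP x)) = ev x by apply/ev_congr/kp_reprP.
exists (fun x => ev (repr x)); split.
  split; last by split; apply/funext => z /=; rewrite evE.
  split.
  - elim/quotW=> x; elim/quotW=> y; rewrite -kp_piD !evE //.
  - move=> a; elim/quotW=> x; rewrite -kp_piZ !evE //.
  - elim/quotW=> x; elim/quotW=> y; rewrite -kp_piM !evE //.
move=> g [[gD gZ gM] [gP gS gSg]].
have g0 : g 0 = 0 by apply: (addrI (g 0)); rewrite -gD !addr0.
apply/funext; elim/quotW=> x; rewrite evE.
elim: x => /= [v|l|l||x IHx y IHy|x IHx|a x IHx|x IHx y IHy].
- by rewrite -gP.
- by rewrite -gS.
- by rewrite -gSg.
- by rewrite g0.
- by rewrite kp_piD gD IHx IHy.
- by rewrite kp_piN IHx; apply: (addIr (g (\pi_KP x))); rewrite -gD !addNr g0.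
- by rewrite kp_piZ gZ IHx.
- by rewrite kp_piM gM IHx IHy.
Qed.

End KumjianPask.

Arguments kp_p {k L R} v.
Arguments kp_s {k L R} l.
Arguments kp_sg {k L R} l.

(* Main.v *)
(** Every element of KP_R(L) is a finite sum of terms r s_a s_b^* over distinct
    pairs (a, b) in which all the b have the same degree.  If x is not 0, some
    pair (a0, b0) with s(a0) = s(b0) has a coefficient r0 that is not 0, and
    s_{a0}^* x s_{b0} is the sum of r0 p_{s(a0)} and of terms r s_{a0}^* s_a
    with a <> a0.  Aperiodicity provides one path l from s(a0) such that a0 l
    and a l have no common extension, for each of the finitely many such a with
    d(a) <> d(a0); then s_l^* s_{a0}^* x s_{b0} s_l = r0 p_{s(l)}.  Hence the
    image of x under pi is not 0. *)
Require Import Defs.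
From HB Require Import structures.
From mathcomp Require Import all_boot all_order all_algebra.
From mathcomp Require Import zify.
Import GRing.Theory.
Local Open Scope ring_scope.
Local Open Scope nuring_scope.
Set Implicit Arguments.
Unset Strict Implicit.
Unset Printing Implicit Defensive.

(** * Arithmetic in rings without identity *)

Section NuRingTheory.
Variable A : nuRingType.
Implicit Types x y : A.

Lemma nu_mul0l x : 0 ** x = 0.
Proof. by apply: (addrI (0 ** x)); rewrite -numulDl !addr0. Qed.

Lemma nu_mul0r x : x ** 0 = 0.
Proof. by apply: (addrI (x ** 0)); rewrite -numulDr !addr0. Qed.

Lemma nu_suml (I : Type) (s : seq I) (F : I -> A) x :
  (\sum_(i <- s) F i) ** x = \sum_(i <- s) F i ** x.
Proof.
exact: (big_morph (fun y => y ** x) (fun y z => numulDl y z x) (nu_mul0l x)).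
Qed.

Lemma nu_sumr (I : Type) (s : seq I) (F : I -> A) x :
  x ** (\sum_(i <- s) F i) = \sum_(i <- s) x ** F i.
Proof. exact: (big_morph _ (numulDr x) (nu_mul0r x)). Qed.

End NuRingTheory.

Lemma degreeD k (m n : degree k) i : (m + n) i = (m i + n i)%N.
Proof. by rewrite ffunE. Qed.

(** * Positions of subpaths in a path, and aperiodicity *)

Section Occurrences.
Variables (k : nat) (L : kgraph k).
Implicit Types (v : obj L) (l x y : mor L) (m n : degree k).

(** [cmp (idm (rng l)) l] and [cmp l (idm (src l))] both factor [l] in degrees 0 and 0, so their
    factors agree. *)
Lemma deg0_idm l : deg l = 0 -> l = idm (src l).
Proof.
move=> l0.
have := @deg_fact_uniq _ _ (idm (rng l)) l l (idm (src l)).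
by rewrite src_id rng_id !deg_id cmp_idl cmp_idr l0 => -[].
Qed.

Lemma deg0_rng l : deg l = 0 -> rng l = src l.
Proof. by move=> /deg0_idm ->; rewrite rng_id src_id. Qed.

Lemma deg_factW l m n : deg l = m + n -> exists a b,
  [/\ deg a = m, deg b = n, src a = rng b & l = cmp a b].
Proof. by move=> /deg_fact[[a b] [abP _]]; exists a, b. Qed.

(** A relational form of x = l(m, m + d(x)), free of truncated subtraction. *)
Definition occurs_at l m x := exists a b,
  [/\ deg a = m, src a = rng x, src x = rng b & l = cmp a (cmp x b)].

Lemma occurs_at_deg l m x : occurs_at l m x ->
  exists n, deg l = m + deg x + n.
Proof.
move=> [a [b [<- ax xb ->]]]; exists (deg b).
by rewrite !deg_cmp ?rng_cmp// addrA.
Qed.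

(** Cancellation in d(l) forces the final parts to have equal degrees; then unique factorization
    applies twice. *)
Lemma occurs_at_uniq l m x y : occurs_at l m x -> occurs_at l m y ->
  deg x = deg y -> x = y.
Proof.
move=> Ox Oy dxy.
have [a [b [da ax xb e]]] := Ox; have [a' [b' [da' ay yb e']]] := Oy.
have dbb : deg b = deg b'.
  have : deg (cmp a (cmp x b)) = deg (cmp a' (cmp y b')) by rewrite -e -e'.
  rewrite !deg_cmp ?rng_cmp// da da' dxy => /ffunP E.
  by apply/ffunP => i; have := E i; rewrite !ffunE => /addnI/addnI.
have [] := @deg_fact_uniq _ _ a (cmp x b) a' (cmp y b').
- by rewrite rng_cmp.
- by rewrite rng_cmp.
- by rewrite da da'.
- by rewrite !deg_cmp// dxy dbb.
- by rewrite -e -e'.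
by move=> _ /(deg_fact_uniq xb yb dxy dbb)[].
Qed.

Lemma occurs_at_ex l m n p : deg l = m + n + p ->
  exists2 x, deg x = n & occurs_at l m x.
Proof.
rewrite -addrA => /deg_factW[a [c [da dc ac ->]]].
have [x [b [dx db xb ce]]] := deg_factW dc.
exists x => //; exists a, b; split=> //; last by rewrite ce.
by rewrite ac ce rng_cmp.
Qed.

Lemma occurs_at_trans l m n x y :
  occurs_at l m x -> occurs_at x n y -> occurs_at l (m + n) y.
Proof.
move=> [a [b [da ax xb ->]]] [a' [b' [da' ay yb xE]]].
have aa : src a = rng a' by rewrite ax xE rng_cmp// rng_cmp.
have bb : src b' = rng b by rewrite -xb xE !src_cmp// rng_cmp.
exists (cmp a a'), (cmp b' b); split.
- by rewrite deg_cmp// da da'.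
- by rewrite src_cmp.
- by rewrite rng_cmp.
- by rewrite xE -!cmpA ?rng_cmp ?src_cmp// ?rng_cmp.
Qed.

Lemma occurs_at_cmp l x : src l = rng x -> occurs_at (cmp l x) (deg l) x.
Proof.
move=> lx; exists l, (idm (src x)).
by split; rewrite ?rng_id// cmp_idr.
Qed.

Lemma occurs_at0 x l : src x = rng l -> occurs_at (cmp x l) 0 x.
Proof.
move=> xl; exists (idm (rng x)), l; split; rewrite ?deg_id ?src_id//.
by rewrite -(rng_cmp xl) cmp_idl.
Qed.

(** The inequality of the aperiodicity condition, with the common degree of the two segments left
    free. This makes it stable under extension of [l] at either end. *)
Definition separates l m n := exists x y,
  [/\ occurs_at l m x, occurs_at l n y, deg x = deg y & x <> y].

Lemma separates_cmpr l l' m n : src l = rng l' ->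
  separates l m n -> separates (cmp l l') m n.
Proof.
move=> /occurs_at0 O [x [y [Ox Oy dxy xy]]].
by exists x, y; split=> //; rewrite -[X in occurs_at _ X]add0r;
   apply: occurs_at_trans O _.
Qed.

(* If the paths of degree d(l') + d(x) at m and n in l'l were equal, their
   final parts, which are x and y, would be equal too. *)
Lemma separates_cmpl l' l m n : src l' = rng l ->
  separates l m n -> separates (cmp l' l) m n.
Proof.
move=> l'l [x [y [Ox Oy dxy xy]]]; have O := occurs_at_cmp l'l.
have long p z : occurs_at l p z -> exists w,
    [/\ occurs_at (cmp l' l) p w, deg w = deg l' + deg z &
        occurs_at w (deg l') z].
  move=> Oz; have [q dl] := occurs_at_deg Oz.
  have [w dw Ow] : exists2 w, deg w = deg l' + deg z &
      occurs_at (cmp l' l) p w.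
    apply: (occurs_at_ex (p := q)).
    by rewrite deg_cmp// dl !addrA (addrC p).
  exists w; split=> //.
  have [z' dz' Oz'] : exists2 z', deg z' = deg z & occurs_at w (deg l') z'.
    by apply: (occurs_at_ex (p := 0)); rewrite addr0.
  suff -> : z = z' by [].
  apply: (occurs_at_uniq (l := cmp l' l) (m := p + deg l')) => //.
    by rewrite addrC; apply: occurs_at_trans O Oz.
  exact: occurs_at_trans Ow Oz'.
have [x' [Ox' dx' xx']] := long _ _ Ox; have [y' [Oy' dy' yy']] := long _ _ Oy.
exists x', y'; split=> //; first by rewrite dx' dy' dxy.
by move=> e; apply: xy; apply: occurs_at_uniq xx' _ dxy; rewrite e.
Qed.

Lemma segment_occurs_at l m n : degle m n -> degle n (deg l) ->
  occurs_at l m (segment l m n) /\ deg (segment l m n) = degsub n m.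
Proof.
move=> mn nl; have [a [b [[da dx db] [ax xb e]]]] := segmentP mn nl.
by split=> //; exists a, b.
Qed.

Lemma aperiodic_separates v m n : aperiodic L -> m != n ->
  exists2 l, rng l = v & separates l m n.
Proof.
move=> apL mn; have [l [rl le_l sl]] := apL v m n mn; exists l => //.
have le_lE i : (maxn (m i) (n i) <= deg l i)%N by have := le_l i; rewrite ffunE.
(* As d(l) is at least the maximum of [m] and [n], the truncated subtraction is exact and both
   segments are genuine. *)
have seg (p : degree k) : (forall i, p i <= maxn (m i) (n i))%N ->
    degle p (degsub (p + deg l) (degmax m n)) /\
    degle (degsub (p + deg l) (degmax m n)) (deg l).
  move=> lep; split=> i; rewrite !(degreeD, ffunE);
    by have := le_lE i; have := lep i; lia.
have [m1 m2] := seg m (fun i => leq_maxl _ _).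
have [n1 n2] := seg n (fun i => leq_maxr _ _).
have [Om dm] := segment_occurs_at m1 m2.
have [On dn] := segment_occurs_at n1 n2.
exists (segment l m (degsub (m + deg l) (degmax m n))).
exists (segment l n (degsub (n + deg l) (degmax m n))).
split=> //; last exact/eqP.
rewrite dm dn; apply/ffunP => i; rewrite !(degreeD, ffunE).
by have := le_lE i; lia.
Qed.

(** Induction on [D]: the path found so far is prolonged from its source by one that separates the
    new pair. By [separates_cmpr] and [separates_cmpl] both separations survive in the composite. *)
Lemma aperiodic_separates_all v (D : seq (degree k * degree k)) :
  aperiodic L -> {in D, forall q, q.1 != q.2} ->
  exists2 l, rng l = v & {in D, forall q, separates l q.1 q.2}.
Proof.
move=> apL; elim: D => [_|q D IH neqD].
  by exists (idm v); rewrite ?rng_id.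
have [|l rl sl] := IH; first by move=> r rD; apply: neqD; rewrite inE rD orbT.
have [l' rl' sl'] := aperiodic_separates (src l) apL (neqD q (mem_head _ _)).
exists (cmp l l'); first by rewrite rng_cmp.
move=> r; rewrite inE => /predU1P[->|rD].
  exact: separates_cmpl.
by apply: separates_cmpr => //; apply: sl.
Qed.

(** The degrees are crossed: the segment of [l] at d(b) lies at d(a) + d(b) in alx, and the one at
    d(a) lies at the same position in bly. A common extension would make them equal. *)
Lemma separates_no_extension a b l x y : separates l (deg b) (deg a) ->
  src a = rng l -> src b = rng l -> src l = rng x -> src l = rng y ->
  cmp (cmp a l) x <> cmp (cmp b l) y.
Proof.
move=> [w [z [Ow Oz dwz wz]]] al bl lx ly e; apply: wz.
have occ c t p u : src c = rng l -> src l = rng t -> occurs_at l p u ->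
    occurs_at (cmp (cmp c l) t) (deg c + p) u.
  move=> cl lt; apply: occurs_at_trans.
  by exists c, t; split=> //; rewrite -cmpA.
apply: occurs_at_uniq (occ _ _ _ _ al lx Ow) _ dwz.
by rewrite e addrC; apply: occ.
Qed.

End Occurrences.

(* With s_v = s_{v^*} = P_v for a vertex v, the relations (KP2)-(KP4) hold
   uniformly in all degrees. *)
Definition kp_ext k (L : kgraph k) (A : nuRingType) (P : obj L -> A)
    (S : nzmor L -> A) (l : mor L) : A :=
  if insub l is Some l' then S l' else P (src l).

(** * Products in a Kumjian-Pask family *)

Section Family.
Variables (k : nat) (L : kgraph k) (A : nuRingType).
Variables (P : obj L -> A) (S Sg : nzmor L -> A).
Hypothesis fam : kp_family P S Sg.
Implicit Types (v : obj L) (l : mor L).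

Local Notation T := (kp_ext P S).
Local Notation Tg := (kp_ext P Sg).

Lemma kp_ext_nz (Q : nzmor L -> A) (l : nzmor L) : kp_ext P Q (val l) = Q l.
Proof. by rewrite /kp_ext valK. Qed.

Lemma kp_ext0 (Q : nzmor L -> A) l : deg l = 0 -> kp_ext P Q l = P (src l).
Proof. by move=> l0; rewrite /kp_ext insubN// l0 eqxx. Qed.

Variant mor_spec l : Prop :=
  | MorVertex of deg l = 0 & rng l = src l
  | MorNz (l' : nzmor L) of l = val l'.

Lemma morP l : mor_spec l.
Proof.
have [l0|l0] := eqVneq (deg l) 0.
  by apply: MorVertex => //; apply: deg0_rng.
exact: (@MorNz _ (exist _ l l0)).
Qed.

Lemma ext_rng l : P (rng l) ** T l = T l.
Proof.
case: (morP l) => [l0 e|l' ->]; first by rewrite kp_ext0// e (kp1_idem fam).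
by rewrite kp_ext_nz (kp2_rng fam).
Qed.

Lemma ext_src l : T l ** P (src l) = T l.
Proof.
case: (morP l) => [l0 e|l' ->]; first by rewrite kp_ext0// (kp1_idem fam).
by rewrite kp_ext_nz (kp2_src fam).
Qed.

Lemma ghost_rng l : Tg l ** P (rng l) = Tg l.
Proof.
case: (morP l) => [l0 e|l' ->]; first by rewrite kp_ext0// e (kp1_idem fam).
by rewrite kp_ext_nz (kp2_grng fam).
Qed.

Lemma ghost_src l : P (src l) ** Tg l = Tg l.
Proof.
case: (morP l) => [l0 e|l' ->]; first by rewrite kp_ext0// (kp1_idem fam).
by rewrite kp_ext_nz (kp2_gsrc fam).
Qed.

Lemma cmp_nz (l m : nzmor L) : src (val l) = rng (val m) ->
  exists lm : nzmor L, val lm = cmp (val l) (val m).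
Proof.
move=> lm; have d0 : deg (cmp (val l) (val m)) != 0.
  apply: contra (valP l) => /eqP; rewrite deg_cmp// => /ffunP e.
  apply/eqP/ffunP => i; have := e i; rewrite !ffunE => /eqP.
  by rewrite addn_eq0 => /andP[/eqP].
by exists (exist _ (cmp (val l) (val m)) d0).
Qed.

Lemma ext_mul l m : src l = rng m -> T l ** T m = T (cmp l m).
Proof.
case: (morP l) => [l0 e lm|l' -> lm].
  have -> : cmp l m = m by rewrite (deg0_idm l0) lm cmp_idl.
  by rewrite (kp_ext0 _ l0) lm ext_rng.
case: (morP m) lm => [m0 e|m' ->] lm.
  have -> : cmp (val l') m = val l' by rewrite (deg0_idm m0) -e -lm cmp_idr.
  by rewrite (kp_ext0 _ m0) -e -lm ext_src.
have [lm' e] := cmp_nz lm.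
by rewrite -e !kp_ext_nz; apply: (kp2_mul fam).
Qed.

Lemma ghost_mul l m : src l = rng m -> Tg m ** Tg l = Tg (cmp l m).
Proof.
case: (morP l) => [l0 e lm|l' -> lm].
  have -> : cmp l m = m by rewrite (deg0_idm l0) lm cmp_idl.
  by rewrite (kp_ext0 _ l0) lm ghost_rng.
case: (morP m) lm => [m0 e|m' ->] lm.
  have -> : cmp (val l') m = val l' by rewrite (deg0_idm m0) -e -lm cmp_idr.
  by rewrite (kp_ext0 _ m0) -e -lm ghost_src.
have [lm' e] := cmp_nz lm.
by rewrite -e !kp_ext_nz; apply: (kp2_gmul fam).
Qed.

(** The orthogonal idempotents at s(l) and r(m) can be inserted between the factors. *)
Lemma ext_mul0 l m : src l <> rng m -> T l ** T m = 0.
Proof.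
move=> /eqP lm; rewrite -ext_src -(ext_rng m) numulA -(numulA (T l)).
by rewrite (kp1_orth fam)// nu_mul0r nu_mul0l.
Qed.

Lemma ghost_mul0 l m : src l <> rng m -> Tg m ** Tg l = 0.
Proof.
move=> /eqP lm; rewrite -ghost_rng -(ghost_src l) numulA -(numulA (Tg m)).
by rewrite (kp1_orth fam) 1?eq_sym// nu_mul0r nu_mul0l.
Qed.

Lemma ext_ghost0 l m : src l <> src m -> T l ** Tg m = 0.
Proof.
move=> /eqP lm; rewrite -ext_src -(ghost_src m) numulA -(numulA (T l)).
by rewrite (kp1_orth fam)// nu_mul0r nu_mul0l.
Qed.

Lemma ghost_ext_eq l : Tg l ** T l = P (src l).
Proof.
case: (morP l) => [l0 e|l' ->]; first by rewrite !kp_ext0// (kp1_idem fam).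
by rewrite !kp_ext_nz (kp3_eq fam).
Qed.

Lemma ghost_ext_neq l m : deg l = deg m -> l <> m -> Tg l ** T m = 0.
Proof.
case: (morP l) => [l0 e dlm lm|l' -> dlm lm].
  have m0 : deg m = 0 by rewrite -dlm.
  (* Distinct morphisms of degree 0 are identities at distinct vertices, so (KP1) takes the place of
     (KP3). *)
  rewrite !kp_ext0// (kp1_orth fam)//; apply/eqP => sl; apply: lm.
  by rewrite (deg0_idm l0) sl -(deg0_idm m0).
case: (morP m) dlm lm => [m0 e|m' ->] dlm lm.
  by have := valP l'; rewrite dlm m0 eqxx.
by rewrite !kp_ext_nz (kp3_neq fam)//; apply/eqP => e; apply: lm; rewrite e.
Qed.

Lemma ghost_ext_cmp l a b : deg l = deg a -> src a = rng b ->
  Tg l ** T (cmp a b) = if l == a then T b else 0.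
Proof.
move=> dla ab; rewrite -ext_mul// numulA.
have [->|/eqP la] := eqVneq l a; first by rewrite ghost_ext_eq ab ext_rng.
by rewrite ghost_ext_neq// nu_mul0l.
Qed.

Lemma ghost_cmp_ext l a b : deg l = deg a -> src a = rng b ->
  Tg (cmp a b) ** T l = if l == a then Tg b else 0.
Proof.
move=> dla ab; rewrite -ghost_mul// -numulA.
have [->|/eqP la] := eqVneq l a; first by rewrite ghost_ext_eq ab ghost_rng.
by rewrite ghost_ext_neq// ?nu_mul0r// => e; apply: la.
Qed.

Hypothesis rfL : row_finite L.

Lemma vertex_sum v n : exists2 ls : seq (mor L),
  {in ls, forall l, rng l = v /\ deg l = n} &
  P v = \sum_(l <- ls) T l ** Tg l.
Proof.
have [->|n0] := eqVneq n 0.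
  (* (KP4) excludes degree 0, where the sum has the single term P_v P_v. *)
  exists [:: idm v].
    by move=> l; rewrite inE => /eqP->; rewrite rng_id deg_id.
  by rewrite big_seq1 !kp_ext0 ?deg_id// src_id (kp1_idem fam).
have [ls lsE] := row_finite_enum v rfL n0; exists (map val ls).
  by move=> _ /mapP[l + ->]; case: lsE => _ lsE /lsE[].
rewrite (kp4 fam n0 lsE) big_map.
by apply: eq_bigr => l _; rewrite !kp_ext_nz.
Qed.

(** Expand the idempotent at r(l) by (KP4) in degree d(l) + d(m), so that every path x of the sum
    can be cut both at d(l), as ab, and at d(m), as cg. By (KP3) its term is s_b s_g^* if l = a and
    m = c, and 0 otherwise. *)
Lemma ghost_mul_ext l m : exists2 ps : seq (mor L * mor L),
  {in ps, forall p, [/\ src l = rng p.1, src m = rng p.2 &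
                        cmp l p.1 = cmp m p.2]} &
  Tg l ** T m = \sum_(p <- ps) T p.1 ** Tg p.2.
Proof.
have [ls lsE e] := vertex_sum (rng l) (deg l + deg m).
rewrite -ghost_rng e nu_sumr nu_suml => {e}.
elim: ls lsE => [_|x ls IH lsE]; first by exists [::]; rewrite ?big_nil.
have [|ps psE e] := IH; first by move=> y yls; apply: lsE; rewrite inE yls orbT.
have [_ dx] := lsE x (mem_head _ _).
have [a [b [da db ab xab]]] := deg_factW dx.
have [c [g [dc dg cg xcg]]] := deg_factW (etrans dx (addrC _ _)).
rewrite big_cons e numulA -numulA {1}xab xcg ghost_ext_cmp// ghost_cmp_ext//.
have [la|_] := eqVneq l a; last by exists ps; rewrite // nu_mul0l add0r.
have [mc|_] := eqVneq m c; last by exists ps; rewrite // nu_mul0r add0r.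
exists ((b, g) :: ps); last by rewrite big_cons.
move=> p; rewrite inE => /predU1P[->|/psE//].
by split; rewrite /= ?la ?mc// -xab -xcg.
Qed.

(** The sum in [ghost_mul_ext] runs over common extensions, so it is empty. *)
Lemma ghost_ext_no_extension l m :
  (forall x y, src l = rng x -> src m = rng y -> cmp l x <> cmp m y) ->
  Tg l ** T m = 0.
Proof.
move=> H; have [[|p ps] psE ->] := ghost_mul_ext l m; first by rewrite big_nil.
by have [lp mp /(H _ _ lp mp)] := psE p (mem_head _ _).
Qed.

(** * Compression of a single term s_a s_b^* *)

Section Cutdown.
Variables (a0 b0 l : mor L).
Hypotheses (a0b0 : src a0 = src b0) (a0l : src a0 = rng l).

Lemma cutdown_eq :
  Tg l ** (Tg a0 ** (T a0 ** Tg b0) ** T b0) ** T l = P (src l).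
Proof.
rewrite !numulA -(numulA _ (Tg b0)) -(numulA (Tg l)) !ghost_ext_eq.
by rewrite -a0b0 a0l !ghost_rng ghost_ext_eq.
Qed.

(** If b differs from b0, (KP3) kills s_b^* s_{b0}, because the degrees agree. Otherwise a differs
    from a0: in equal degrees (KP3) kills s_{a0}^* s_a, and in different degrees the product reduces
    to s_{a0 l}^* s_{a l}, which vanishes as [l] excludes a common extension. *)
Lemma cutdown_neq a b : deg b = deg b0 -> (a, b) <> (a0, b0) ->
  (deg a <> deg a0 -> separates l (deg a) (deg a0)) ->
  Tg l ** (Tg a0 ** (T a ** Tg b) ** T b0) ** T l = 0.
Proof.
move=> db neq sep.
have [bb0|/eqP bb0] := eqVneq b b0; last first.
  by rewrite -!numulA (numulA (Tg b)) ghost_ext_neq// nu_mul0l !nu_mul0r.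
have aa0 : a <> a0 by move=> aa0; apply: neq; rewrite aa0 bb0.
have [da|/eqP da] := eqVneq (deg a) (deg a0).
  by rewrite !numulA -(numulA (Tg l)) ghost_ext_neq ?nu_mul0r ?nu_mul0l// => e;
    apply: aa0.
rewrite bb0 -!numulA (numulA (Tg b0)) ghost_ext_eq -a0b0 a0l ext_rng.
have [al|/eqP al] := eqVneq (src a) (rng l); last first.
  by rewrite ext_mul0// !nu_mul0r.
rewrite (numulA (Tg l)) ghost_mul// ext_mul//.
apply: ghost_ext_no_extension => x y; rewrite !src_cmp// => lx ly.
by apply: separates_no_extension => //; apply: sep.
Qed.

End Cutdown.

End Family.

(** * Spanning by the elements s_a s_b^*, and a normal form *)

Section Span.
Variables (k : nat) (L : kgraph k) (R : comPzRingType) (A : nuAlgType R).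
Variables (P : obj L -> A) (S Sg : nzmor L -> A).
Hypotheses (fam : kp_family P S Sg) (rfL : row_finite L).
Implicit Types (D : mor L * mor L -> Prop) (x y : A).

Local Notation T := (kp_ext P S).
Local Notation Tg := (kp_ext P Sg).
Local Notation E p := (T p.1 ** Tg p.2).

(** Repeated pairs are allowed, which keeps closure under sums a mere concatenation;
    [spanned_normal] removes them. Pairs with s(a) different from s(b) are allowed too: their terms
    are 0. *)
Definition spanned D x := exists2 F : seq (R * (mor L * mor L)),
  {in F, forall f, D f.2} & x = \sum_(f <- F) f.1 *: E f.2.

Lemma spanned0 D : spanned D 0.
Proof. by exists [::]; rewrite ?big_nil. Qed.

Lemma spannedD D x y : spanned D x -> spanned D y -> spanned D (x + y).
Proof.
move=> [F FD ->] [G GD ->]; exists (F ++ G); last by rewrite big_cat.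
by move=> f; rewrite mem_cat => /orP[/FD|/GD].
Qed.

Lemma spannedZ D r x : spanned D x -> spanned D (r *: x).
Proof.
move=> [F FD ->]; exists [seq (r * f.1, f.2) | f <- F].
  by move=> _ /mapP[f fF ->]; exact: FD fF.
by rewrite big_map scaler_sumr; apply: eq_bigr => f _; rewrite scalerA.
Qed.

Lemma spanned_sum D (I : eqType) (s : seq I) (F : I -> A) :
  {in s, forall i, spanned D (F i)} -> spanned D (\sum_(i <- s) F i).
Proof.
elim: s => [_|i s IH sD]; first by rewrite big_nil; apply: spanned0.
rewrite big_cons; apply: spannedD; first exact/sD/mem_head.
by apply: IH => j js; apply: sD; rewrite inE js orbT.
Qed.

Lemma spanned_gen D p : D p -> spanned D (E p).
Proof.
move=> Dp; exists [:: (1, p)]; last by rewrite big_seq1 scale1r.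
by move=> f; rewrite inE => /eqP->.
Qed.

(** Expanding s_b^* s_c into terms s_u s_v^* turns s_a s_b^* s_c s_d^* into a sum of terms s_{au}
    s_{dv}^*. *)
Lemma spanned_mul x y :
  spanned (fun=> True) x -> spanned (fun=> True) y ->
  spanned (fun=> True) (x ** y).
Proof.
move=> [F _ ->] [G _ ->]; rewrite nu_suml.
apply: spanned_sum => -[r [a b]] _; rewrite nu_sumr.
apply: spanned_sum => -[t [c d]] _ /=.
rewrite -nuscaleAl -nuscaleAr; do 2 apply: spannedZ.
have [ps _ e] := ghost_mul_ext fam rfL b c.
rewrite numulA -(numulA (T a)) e nu_sumr nu_suml.
apply: spanned_sum => -[u v] _ /=.
have [au|/eqP au] := eqVneq (src a) (rng u); last first.
  by rewrite numulA (ext_mul0 fam)// !nu_mul0l; apply: spanned0.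
have [dv|/eqP dv] := eqVneq (src d) (rng v); last first.
  by rewrite -!numulA (ghost_mul0 fam)// !nu_mul0r; apply: spanned0.
rewrite numulA (ext_mul fam)// -numulA (ghost_mul fam)//.
exact: (@spanned_gen _ (_, _)).
Qed.

Lemma spanned_vertex v : spanned (fun=> True) (P v).
Proof.
have [ls _ ->] := vertex_sum fam rfL v 0.
by apply: spanned_sum => l _; apply: (@spanned_gen _ (l, l)).
Qed.

Lemma spanned_ext l : spanned (fun=> True) (T l).
Proof.
rewrite -(ext_src fam).
suff -> : P (src l) = kp_ext P Sg (idm (src l)).
  exact: (@spanned_gen _ (l, idm (src l))).
by rewrite kp_ext0 ?deg_id// src_id.
Qed.

Lemma spanned_ghost l : spanned (fun=> True) (Tg l).
Proof.
rewrite -(ghost_src fam).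
suff -> : P (src l) = kp_ext P S (idm (src l)).
  exact: (@spanned_gen _ (idm (src l), l)).
by rewrite kp_ext0 ?deg_id// src_id.
Qed.

(** Inserting (KP4) in degree [m] between s_a and s_b^* gives a sum of terms s_{al} s_{bl}^*. *)
Lemma spanned_raise p m n : deg p.2 + m = n ->
  spanned (fun q => deg q.2 = n) (E p).
Proof.
move=> pmn; have [ls lsE e] := vertex_sum fam rfL (src p.1) m.
rewrite -(ext_src fam) e nu_sumr nu_suml.
apply: spanned_sum => l /lsE[rl dl].
have [pl|/eqP pl] := eqVneq (src p.2) (rng l); last first.
  by rewrite -!numulA (ghost_mul0 fam)// !nu_mul0r; apply: spanned0.
rewrite numulA (ext_mul fam) -?numulA ?(ghost_mul fam)//.
by apply: (@spanned_gen _ (_, _)); rewrite /= deg_cmp// dl.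
Qed.

Lemma spanned_uniform x : spanned (fun=> True) x ->
  exists n, spanned (fun q => deg q.2 = n) x.
Proof.
(* The sum of all the degrees serves as common bound: the amount by which one of them is raised is
   the sum of the others. *)
move=> [F _ ->]; exists (\sum_(f <- F) deg f.2.2).
apply: spanned_sum => f fF; apply: spannedZ.
by apply: spanned_raise; rewrite (big_rem f fF).
Qed.

(** The coefficients of equal pairs are added up; some of the resulting ones may be 0. *)
Lemma spanned_normal D x : spanned D x ->
  exists (G : seq (mor L * mor L)) (c : mor L * mor L -> R),
  [/\ uniq G, {in G, forall p, D p} & x = \sum_(p <- G) c p *: E p].
Proof.
move=> [F FD ->].
exists (undup (map snd F)), (fun p => \sum_(f <- F | f.2 == p) f.1).
split; first exact: undup_uniq.
  by move=> p; rewrite mem_undup => /mapP[f fF ->]; apply: FD.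
under [RHS]eq_bigr do rewrite scaler_suml.
rewrite (exchange_big_dep xpredT)//= [LHS]big_seq [RHS]big_seq.
apply: eq_bigr => f fF; under eq_bigl do rewrite eq_sym.
rewrite -big_filter filter_pred1_uniq ?undup_uniq ?big_seq1//.
by rewrite mem_undup map_f.
Qed.

End Span.

(** * From a nonzero element to a multiple of a vertex idempotent *)

Section UniquenessTheorem.
Variables (k : nat) (L : kgraph k) (R : comPzRingType).
Hypothesis rfL : row_finite L.

Local Notation T := (kp_ext kp_p kp_s : mor L -> KP L R).
Local Notation Tg := (kp_ext kp_p kp_sg : mor L -> KP L R).

(** Induction on a formal expression that represents [x]. *)
Lemma KP_spanned (x : KP L R) : spanned kp_p kp_s kp_sg (fun=> True) x.
Proof.
have fam := kp_familyP L R.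
elim/quotW: x; elim=> [v|l|l||x IHx y IHy|x IHx|a x IHx|x IHx y IHy].
- exact: spanned_vertex.
- by have := spanned_ext fam (val l); rewrite kp_ext_nz.
- by have := spanned_ghost fam (val l); rewrite kp_ext_nz.
- exact: spanned0.
- by rewrite kp_piD; apply: spannedD.
- by rewrite kp_piN -scaleN1r; apply: spannedZ.
- by rewrite kp_piZ; apply: spannedZ.
- by rewrite kp_piM; apply: spanned_mul.
Qed.

Lemma KP_cutdown (x : KP L R) : aperiodic L -> x != 0 ->
  exists (y z : KP L R) r v, r != 0 /\ y ** x ** z = r *: kp_p v.
Proof.
move=> apL; have fam := kp_familyP L R.
have [n /spanned_normal[G [c [uG Gn ->]]]] :=
  spanned_uniform fam rfL (KP_spanned x).
move=> x0.
have [[a0 b0] pG /andP[c0 /eqP a0b0]] :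
    exists2 p, p \in G & (c p != 0) && (src p.1 == src p.2).
  (* Without such a pair every term vanishes, by its coefficient or by its sources, and the element
     would be 0. *)
  apply/hasP; apply: contraNT x0 => /hasPn none; apply/eqP.
  rewrite big_seq big1// => p /none; rewrite negb_and negbK.
  case/orP => [/eqP->|/eqP ne]; first by rewrite scale0r.
  by rewrite (ext_ghost0 fam)// scaler0.
(* Only the a with d(a) different from d(a0) have to be separated from a0; (KP3) handles the
   rest. *)
pose D := [seq (deg p.1, deg a0) | p <- G & deg p.1 != deg a0].
have [|l rl sl] := @aperiodic_separates_all _ L (src a0) D apL.
  by move=> _ /mapP[p + ->]; rewrite mem_filter => /andP[].
exists (Tg l ** Tg a0), (T b0 ** T l), (c (a0, b0)), (src l); split=> //.
rewrite nu_sumr nu_suml (bigD1_seq (a0, b0))//= big_seq_cond big1 ?addr0.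
  rewrite -nuscaleAr -nuscaleAl; congr (_ *: _).
  by rewrite -(cutdown_eq fam a0b0 (esym rl)) !numulA.
move=> [a b] /andP[abG /eqP ne]; rewrite -nuscaleAr -nuscaleAl.
have -> : Tg l ** Tg a0 ** (T a ** Tg b) ** (T b0 ** T l) = 0.
  rewrite -[RHS](cutdown_neq fam rfL a0b0 (esym rl) _ ne) ?numulA//.
    by rewrite (Gn _ abG) (Gn _ pG).
  move=> /eqP da; apply: (sl (_, _)); apply/mapP; exists (a, b) => //.
  by rewrite mem_filter da.
by rewrite scaler0.
Qed.

End UniquenessTheorem.

Unset Implicit Arguments.

Theorem theorem4p7 (k : nat) (k_gt0 : (0 < k)%N) (L : kgraph k)
    (L_aperiodic : aperiodic L) (L_row_finite : row_finite L)
    (L_no_sources : no_sources L)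
    (R : comPzRingType) (A : nuRingType)
    (pi : {additive KP L R -> A})
    (pi_mul : {morph pi : x y / x ** y >-> x ** y})
    (pi_neq0 : forall (r : R) (v : obj L), r != 0 -> pi (r *: kp_p v) != 0) :
  injective pi.
Proof.
(* It suffices that the kernel is 0. A nonzero x in it would bring y x z = r p_v into it as well;
   the scalar stays inside [pi], which is only a ring homomorphism. *)
apply: raddf_inj => x pix0; apply: contraTeq isT => x0.
have [y [z [r [v [r0 e]]]]] := KP_cutdown L_row_finite L_aperiodic x0.
by have := pi_neq0 r v r0; rewrite -e !pi_mul pix0 nu_mul0r nu_mul0l eqxx.
Qed.
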